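(* Let $S^\star\subseteq\mathcal{A}=\{1,\dots,M\}$ with $|S^\star|=k$ and let $W^\star\in\mathbb{R}^{M\times d}$ satisfy $W^\star_a=0$ for all $a\notin S^\star$. Let data $(z_t,a_t,r_t)_{t=1}^T$ be generated by $r_t=\langle W^\star_{a_t},z_t\rangle+\varepsilon_t$. Assume that $z_1,\dots,z_T\in\mathbb{R}^d$ are independent, mean-zero, sub-Gaussian with covariance $\Sigma_z\succ0$ satisfying $\kappa\le\lambda_{\min}(\Sigma_z)\le\lambda_{\max}(\Sigma_z)\le\Lambda$ for constants $\kappa,\Lambda>0$ and $\|z_t\|_{\psi_2}\le L_z$ for all $t$; that $\varepsilon_1,\dots,\varepsilon_T$ are independent, mean-zero, sub-Gaussian with $\|\varepsilon_t\|_{\psi_2}\le L_\varepsilon$, independent of $\{z_t\}_{t=1}^T$; that the estimated support satisfies $\widehat S=S^\star$; and that $\lambda_{\min}(G_{S^\star})\ge\alpha T$ for some $\alpha>0$. Then the refitted least-squares estimator $\hat w_{S^\star}$ (with blocks $\hat W_j$, $j\in S^\star$) satisfies $$\|\hat w_{S^\star}-w^\star_{S^\star}\|_2\le\frac{2}{\alpha T}\,\|\Psi_{S^\star}^\top\varepsilon\|_2 .$$ Moreover, for any (possibly random) new state $z\in\mathbb{R}^d$, $$\langle W^\star_{a^\star(z)},z\rangle-\langle W^\star_{\hat a(z)},z\rangle\le 2\max_{j\in S^\star}\|\hat W_j-W^\star_j\|_2\cdot\|z\|_2,$$ where $a^\star(z)\in\arg\max_{j\in\mathcal{A}}\langle W^\star_j,z\rangle$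 is the optimal action under the true model and $\hat a(z)\in\arg\max_{j\in\widehat S}\langle\hat W_j,z\rangle$. In particular, since $W^\star_j=0$ for $j\notin S^\star$, the maximizer of $\langle W^\star_j,z\rangle$ over $j\in\mathcal{A}$ equals the maximizer over $j\in S^\star$, so that $\hat a(z)$ is near-optimal over the full action space, in the sense that $\max_{j\in\mathcal{A}}\langle W^\star_j,z\rangle-\langle W^\star_{\hat a(z)},z\rangle\le 2\max_{j\in S^\star}\|\hat W_j-W^\star_j\|_2\cdot\|z\|_2$.
   Context: Setting. $\mathcal{A}=\{1,\dots,M\}$ is a finite action set, $z_t\in\mathbb{R}^d$ is a latent state available to the agent at time $t$, $a_t\in\mathcal{A}$ is the action selected at time $t$ (actions may be selected adaptively or non-adaptively), $r_t\in\mathbb{R}$ is the observed reward, $W^\star\in\mathbb{R}^{M\times d}$ is an unknown matrix with $a$-th row $W^\star_a$ (viewed as a vector in $\mathbb{R}^d$). Write $r=(r_1,\dots,r_T)^\top$, $\varepsilon=(\varepsilon_1,\dots,\varepsilon_T)^\top$. Block design. For $j\in\mathcal{A}$, $\Psi_j\in\mathbb{R}^{T\times d}$ is the matrix whose $t$-th row is $z_t^\top$ if $a_t=j$ and $0^\top$ otherwise. For $S\subseteq\mathcal{A}$, $\Psi_S\in\mathbb{R}^{T\times|S|d}$ is the column concatenation of $\{\Psi_j\}_{j\in S}$, $G_S:=\Psi_S^\top\Psi_S$, and $w^\star_S\in\mathbb{R}^{|S|d}$ is the vector stacking the blocks $W^\star_j$, $j\in S$. Thus $r=\Psi_{S^\star}w^\star_{S^\star}+\varepsilon$.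 Refit. Given an estimated support $\widehat S\subseteq\mathcal{A}$ of size $k$, $\hat w_{\widehat S}\in\arg\min_{w\in\mathbb{R}^{kd}}\|r-\Psi_{\widehat S}w\|_2^2$, and $\hat W_j\in\mathbb{R}^d$ ($j\in\widehat S$) denotes the $j$-th block of $\hat w_{\widehat S}$. $\|\cdot\|_{\psi_2}$ is the sub-Gaussian norm; $\lambda_{\min},\lambda_{\max}$ are the extreme eigenvalues.
   Formalization: The bounds against the optimum over all of A are false when S* ≠ A and every ⟨W*_j,z⟩, j∈S*, is negative; they are proved for z where max over A of ⟨W*_j,z⟩ equals max over S*. For every z, the bound is proved against the maximum over S*. *)

(* Defs.v *)
From HB Require Import structures.
From mathcomp Require Import all_boot all_order all_algebra.
From mathcomp Require Import all_classical all_reals all_analysis.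
Set Implicit Arguments.
Unset Strict Implicit.
Unset Printing Implicit Defensive.
Import Order.TTheory GRing.Theory Num.Theory.
Import numFieldNormedType.Exports.
Local Open Scope classical_set_scope.
Local Open Scope ring_scope.

Definition dot (R : realType) (n : nat) (u v : 'cV[R]_n) : R :=
  \sum_i u i 0 * v i 0.

(* The Euclidean norm; the library's norm on matrices is the sup norm. *)
Definition norm2 (R : realType) (n : nat) (v : 'cV[R]_n) : R :=
  Num.sqrt (\sum_i v i 0 ^+ 2).

(* For a symmetric real matrix of positive size the spectrum is finite and
   nonempty, so [inf] and [sup] are a minimum and a maximum.  At size 0 the
   spectrum is empty and both values are 0. *)
Definition lambda_min (R : realType) (n : nat) (A : 'M[R]_n) : R :=
  inf [set x | eigenvalue A x].

Definition lambda_max (R : realType) (n : nat) (A : 'M[R]_n) : R :=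
  sup [set x | eigenvalue A x].

Definition posdef (R : realType) (n : nat) (A : 'M[R]_n) : Prop :=
  A^T = A /\ forall v : 'cV[R]_n, v != 0 -> 0 < dot v (A *m v).

Definition is_argmax (R : realType) (I : finType) (S : {set I}) (f : I -> R)
    (j : I) : Prop :=
  j \in S /\ forall i, i \in S -> f i <= f j.

(* [sup] of a finite set of reals: a maximum whenever S is nonempty. *)
Definition max_over (R : realType) (I : finType) (S : {set I}) (f : I -> R) : R :=
  sup [set f j | j in [set` S]].

Section Probability.
Context (R : realType) (d : measure_display) (Omega : measurableType d)
  (P : probability Omega R).

Definition borel (E : topologicalType) : set (set E) := <<s (@open E) >>.

Definition sigma_of (E : topologicalType) (X : Omega -> E) : set (set Omega) :=
  preimage_set_system [set: Omega] X (@borel E).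

Definition sigma_of_family (E : topologicalType) (I : Type)
    (X : I -> Omega -> E) : set (set Omega) :=
  <<s \bigcup_(i in [set: I]) sigma_of (X i) >>.

Definition random_element (E : topologicalType) (X : Omega -> E) : Prop :=
  sigma_of X `<=` measurable.

Definition mutually_independent (E : topologicalType) (I : finType)
    (X : I -> Omega -> E) : Prop :=
  forall (J : {set I}) (A : I -> set Omega),
    (forall i, i \in J -> sigma_of (X i) (A i)) ->
    (P (\bigcap_(i in [set` J]) A i) = \prod_(i in J) P (A i))%E.

Definition independent_sigma (F G : set (set Omega)) : Prop :=
  forall A B, F A -> G B -> (P (A `&` B) = P A * P B)%E.

Definition psi2_norm (X : Omega -> R) : \bar R :=
  ereal_inf [set s%:E | s in
    [set s : R | 0 < s /\
      ('E_P[fun w => (expR (X w ^+ 2 / s ^+ 2))%R] <= 2%:E)%E]].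

Definition psi2_norm_vec (n : nat) (X : Omega -> 'cV[R]_n) : \bar R :=
  ereal_sup [set psi2_norm (fun w => dot u (X w)) | u in
    [set u : 'cV[R]_n | norm2 u = 1]].

Definition mean_zero_vec (n : nat) (X : Omega -> 'cV[R]_n) : Prop :=
  forall i, ('E_P[fun w => (X w i 0)%R] = 0)%E.

Definition has_covariance (n : nat) (X : Omega -> 'cV[R]_n) (Sigma : 'M[R]_n)
    : Prop :=
  forall i j,
    covariance P (fun w => X w i 0) (fun w => X w j 0) = (Sigma i j)%:E.

End Probability.

Section BlockDesign.
Context (R : realType) (M d T : nat).

Definition Wrow (W : 'M[R]_(M, d)) (j : 'I_M) : 'cV[R]_d := (row j W)^T.

Definition design_block (z : 'I_T -> 'cV[R]_d) (a : 'I_T -> 'I_M) (j : 'I_M)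
    : 'M[R]_(T, d) :=
  \matrix_(t, c) (if a t == j then z t c 0 else 0).

(* The blocks are indexed by S through [enum_val : 'I_#|S| -> 'I_M]; the
   dimension [\sum_(i < #|S|) d] is |S| d, in the library's block form. *)
Definition design (z : 'I_T -> 'cV[R]_d) (a : 'I_T -> 'I_M) (S : {set 'I_M})
    : 'M[R]_(T, \sum_(i < #|S|) d) :=
  \mxrow_(i < #|S|) design_block z a (enum_val i).

Definition gram (z : 'I_T -> 'cV[R]_d) (a : 'I_T -> 'I_M) (S : {set 'I_M})
    : 'M[R]_(\sum_(i < #|S|) d) :=
  (design z a S)^T *m design z a S.

Definition stack (W : 'M[R]_(M, d)) (S : {set 'I_M})
    : 'cV[R]_(\sum_(i < #|S|) d) :=
  \mxcol_(i < #|S|) Wrow W (enum_val i).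

(* The block of w with action label j (0 if j is not in S). *)
Definition block (S : {set 'I_M}) (w : 'cV[R]_(\sum_(i < #|S|) d)) (j : 'I_M)
    : 'cV[R]_d :=
  if [pick i : 'I_#|S| | enum_val i == j] is Some i then submxcol w i else 0.

End BlockDesign.

Definition is_least_squares (R : realType) (m n : nat) (A : 'M[R]_(m, n))
    (y : 'cV[R]_m) (w : 'cV[R]_n) : Prop :=
  forall w' : 'cV[R]_n,
    norm2 (y - A *m w) ^+ 2 <= norm2 (y - A *m w') ^+ 2.

(* Main.v *)
Require Import Defs.
From HB Require Import structures.
From mathcomp Require Import all_boot all_order all_algebra.
From mathcomp Require Import all_classical all_reals all_analysis.
From mathcomp Require Import ring lra.
Set Implicit Arguments.
Unset Strict Implicit.
Unset Printing Implicit Defensive.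
Import Order.TTheory GRing.Theory Num.Theory.
Import numFieldNormedType.Exports.
Local Open Scope classical_set_scope.
Local Open Scope ring_scope.

(* Comparing the least-squares residual with that of the true weights and
   bounding the Gram form from below by its least eigenvalue gives the
   estimation error; the factor 2 is that of the basic inequality.  The regret
   bound swaps true and estimated rewards at the best and at the chosen action,
   each swap costing at most [err * |x|] by Cauchy-Schwarz. *)

(** * Euclidean inner product and norm *)

Section EuclideanSpace.
Context (R : realType).
Implicit Types (m n : nat).

Lemma dotC n (u v : 'cV[R]_n) : dot u v = dot v u.
Proof. by apply: eq_bigr => i _; rewrite mulrC. Qed.

Lemma dotDl n (u1 u2 v : 'cV[R]_n) : dot (u1 + u2) v = dot u1 v + dot u2 v.
Proof. by rewrite -big_split; apply: eq_bigr => i _; rewrite mxE mulrDl. Qed.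

Lemma dotZl n c (u v : 'cV[R]_n) : dot (c *: u) v = c * dot u v.
Proof. by rewrite mulr_sumr; apply: eq_bigr => i _; rewrite mxE mulrA. Qed.

Lemma dotDr n (u v1 v2 : 'cV[R]_n) : dot u (v1 + v2) = dot u v1 + dot u v2.
Proof. by rewrite dotC dotDl !(dotC u). Qed.

Lemma dotZr n c (u v : 'cV[R]_n) : dot u (c *: v) = c * dot u v.
Proof. by rewrite dotC dotZl dotC. Qed.

Lemma dotNl n (u v : 'cV[R]_n) : dot (- u) v = - dot u v.
Proof. by rewrite -scaleN1r dotZl mulN1r. Qed.

Lemma dotNr n (u v : 'cV[R]_n) : dot u (- v) = - dot u v.
Proof. by rewrite dotC dotNl dotC. Qed.

Definition dotE := (dotDl, dotDr, dotNl, dotNr, dotZl, dotZr).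

Lemma dot_mulmxr m n (A : 'M[R]_(m, n)) (u : 'cV[R]_m) (v : 'cV[R]_n) :
  dot u (A *m v) = dot (A^T *m u) v.
Proof.
have dotM p (x y : 'cV[R]_p) : dot x y = (x^T *m y) 0 0.
  by rewrite mxE; apply: eq_bigr => i _; rewrite mxE.
by rewrite !dotM trmx_mul trmxK mulmxA.
Qed.

Lemma dotvv_ge0 n (v : 'cV[R]_n) : 0 <= dot v v.
Proof. by apply: sumr_ge0 => i _; rewrite -expr2 sqr_ge0. Qed.

Lemma dotvv_eq0 n (v : 'cV[R]_n) : (dot v v == 0) = (v == 0).
Proof.
apply/eqP/eqP => [/eqP|->]; last by apply: big1 => i _; rewrite !mxE mul0r.
rewrite psumr_eq0 => [/allP v0|i _]; last by rewrite -expr2 sqr_ge0.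
apply/colP => i; rewrite mxE; apply/eqP.
by have := v0 i (mem_index_enum i); rewrite mulf_eq0 orbb.
Qed.

Lemma dotvv_gt0 n (v : 'cV[R]_n) : (0 < dot v v) = (v != 0).
Proof. by rewrite lt0r dotvv_ge0 dotvv_eq0 andbT. Qed.

Lemma norm2_ge0 n (v : 'cV[R]_n) : 0 <= norm2 v.
Proof. exact: sqrtr_ge0. Qed.

Lemma norm2_sqr n (v : 'cV[R]_n) : norm2 v ^+ 2 = dot v v.
Proof.
rewrite sqr_sqrtr; first by apply: eq_bigr => i _; rewrite expr2.
by apply: sumr_ge0 => i _; rewrite sqr_ge0.
Qed.

Lemma norm2N n (v : 'cV[R]_n) : norm2 (- v) = norm2 v.
Proof. by congr Num.sqrt; apply: eq_bigr => i _; rewrite mxE sqrrN. Qed.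

Lemma dot_sqr_le n (u v : 'cV[R]_n) : dot u v ^+ 2 <= dot u u * dot v v.
Proof.
have [->|v0] := eqVneq v 0.
  by rewrite -(scale0r (0 : 'cV_n)) !dotE; lra.
have vv_gt0 : 0 < dot v v by rewrite dotvv_gt0.
(* This vector is [dot v v] times the part of [u] orthogonal to [v]; its squared norm is [dot v v]
   times the Cauchy-Schwarz gap. *)
have := dotvv_ge0 (dot v v *: u - dot u v *: v).
rewrite !dotE (dotC v u) -subr_ge0 => h.
rewrite -subr_ge0 -(pmulr_rge0 _ vv_gt0).
by apply: le_trans h _; rewrite le_eqVlt; apply/orP; left; apply/eqP; ring.
Qed.

Lemma dot_le n (u v : 'cV[R]_n) : dot u v <= norm2 u * norm2 v.
Proof.
rewrite (le_trans (ler_norm _))// -ler_sqr ?nnegrE ?mulr_ge0 ?norm2_ge0//.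
by rewrite real_normK ?num_real// exprMn !norm2_sqr dot_sqr_le.
Qed.

End EuclideanSpace.

(** * Quadratic forms and the least eigenvalue *)

Section SymmetricSpectrum.
Context (R : realType).

(** Cauchy-Schwarz on each row yields the squared Frobenius norm [F]; adding 1 keeps the constant
    positive even for [A = 0]. *)
Lemma mulmx_bounded m n (A : 'M[R]_(m, n)) :
  exists2 C, 0 < C & forall v : 'cV[R]_n, dot (A *m v) (A *m v) <= C * dot v v.
Proof.
pose F := \sum_i dot (row i A)^T (row i A)^T.
have F_ge0 : 0 <= F by apply: sumr_ge0 => i _; exact: dotvv_ge0.
exists (1 + F) => [|v]; first by lra.
have FA : dot (A *m v) (A *m v) <= F * dot v v.
  rewrite mulr_suml; apply: ler_sum => i _; rewrite -expr2.
  have -> : (A *m v) i 0 = dot (row i A)^T v.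
    by rewrite mxE; apply: eq_bigr => j _; rewrite !mxE.
  exact: dot_sqr_le.
by have := dotvv_ge0 v; lra.
Qed.

(** Expanding |v + A v|^2 and |v - A v|^2, both nonnegative, bounds twice the form in absolute value
    by |v|^2 + |A v|^2. *)
Lemma quad_form_bounded n (A : 'M[R]_n) :
  exists2 C, 0 < C & forall v : 'cV[R]_n, `|dot v (A *m v)| <= C * dot v v.
Proof.
have [C C0 CA] := mulmx_bounded A.
exists (1 + C) => [|v]; first by lra.
have := dotvv_ge0 (v + A *m v); have := dotvv_ge0 (v - A *m v).
rewrite !dotE (dotC (A *m v) v) ler_norml; have := CA v; have := dotvv_ge0 v.
move=> v0 ? ? ?; apply/andP; split; nra.
Qed.

(* Since A is positive semidefinite, [0 <= q (v - t A v)] for the form q of A;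
   with t the inverse of a bound on q this gives [|A v|^2 <= C q(v)]. *)
Lemma posdef_of_unitmx n (A : 'M[R]_n) : A^T = A -> A \in unitmx ->
  (forall v, 0 <= dot v (A *m v)) ->
  exists2 c, 0 < c & forall v, c * dot v v <= dot v (A *m v).
Proof.
move=> symA unitA psdA.
have [K K0 KA] := mulmx_bounded (invmx A).
have [C C0 CA] := quad_form_bounded A.
(* [K] bounds the inverse, so |v|^2 <= K |A v|^2, to be chained with |A v|^2 <= C <v, A v>. *)
exists (K^-1 * C^-1) => [|v]; first by rewrite mulr_gt0 ?invr_gt0.
have := KA (A *m v); rewrite mulKmx// => vK.
have := psdA (v - C^-1 *: (A *m v)).
rewrite mulmxBr -scalemxAr !dotE [dot v (A *m (A *m v))]dot_mulmxr symA.
have := ler_normlW (CA (A *m v)).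
set p := dot (A *m v) (A *m v) in vK *.
set q := dot (A *m v) (A *m (A *m v)) => qC h.
have qC' : C^-1 * (C^-1 * q) <= C^-1 * p.
  by rewrite ler_pM2l ?invr_gt0// mulrC ler_pdivrMr// mulrC.
apply: (@le_trans _ _ (C^-1 * p)); last lra.
rewrite mulrAC mulrC ler_pM2l ?invr_gt0//.
by rewrite mulrC ler_pdivrMr// mulrC.
Qed.

(** [eigenvalue] refers to row vectors; by symmetry the transpose is a column eigenvector. *)
Lemma eigenvalue_quad_form n (A : 'M[R]_n) x : A^T = A -> eigenvalue A x ->
  exists2 v : 'cV[R]_n, v != 0 & dot v (A *m v) = x * dot v v.
Proof.
move=> symA /eigenvalueP [u uA u0].
exists u^T; first by rewrite trmx_eq0.
by rewrite -{1}symA -trmx_mul uA linearZ /= dotZr.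
Qed.

(* The infimum of the Rayleigh quotient is an eigenvalue: otherwise
   [A - mu] would be invertible, hence coercive, contradicting the infimum. *)
Lemma lambda_min_le_quad_form n (A : 'M[R]_n) (v : 'cV[R]_n) : A^T = A ->
  lambda_min A * dot v v <= dot v (A *m v).
Proof.
move=> symA.
(* In dimension 0 this is the only case; a nonzero [v] later makes the set [E] of Rayleigh quotients
   nonempty. *)
have [->|v0] := eqVneq v 0.
  by rewrite -(scale0r (0 : 'cV_n)) -scalemxAr !dotE; lra.
pose E := [set dot u (A *m u) | u in [set u : 'cV[R]_n | dot u u = 1]].
pose nrm (u : 'cV[R]_n) := (norm2 u)^-1 *: u.
have nrmE u B : dot (nrm u) (B *m nrm u) = dot u (B *m u) / dot u u.
  rewrite -scalemxAr !dotE -norm2_sqr expr2 invfM; ring.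
have dot_nrm u : u != 0 -> dot (nrm u) (nrm u) = 1.
  move=> u0; have := nrmE u 1%:M; rewrite !mul1mx => ->.
  by rewrite divff// dotvv_eq0.
have [C C0 CA] := quad_form_bounded A.
have E_lb : has_lbound E.
  exists (- C) => _ [u /= u1 <-].
  by have := CA u; rewrite u1 mulr1 ler_norml => /andP[].
have E_inf : has_inf E.
  by split=> //; exists (dot (nrm v) (A *m nrm v)), (nrm v) => //=; exact: dot_nrm.
pose mu := inf E.
have muA u : mu * dot u u <= dot u (A *m u).
  have [->|u0] := eqVneq u 0.
    by rewrite -(scale0r (0 : 'cV_n)) -scalemxAr !dotE; lra.
  rewrite -ler_pdivlMr ?dotvv_gt0// -nrmE; apply: ge_inf => //.
  by exists (nrm u) => //; exact: dot_nrm.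
have mu_eig : eigenvalue A mu.
  apply: contraT => not_eig; pose B := A - mu%:M.
  have BE u : dot u (B *m u) = dot u (A *m u) - mu * dot u u.
    by rewrite mulmxBl mul_scalar_mx !dotE.
  have symB : B^T = B by rewrite linearB /= symA tr_scalar_mx.
  have unitB : B \in unitmx.
    (* The eigenspace at [mu] is by definition the kernel of [B]. *)
    by rewrite -row_free_unit -kermx_eq0; move: not_eig; rewrite negbK.
  have psdB u : 0 <= dot u (B *m u) by rewrite BE subr_ge0.
  have [c c0 cB] := posdef_of_unitmx symB unitB psdB.
  (* Some unit vector has form value below [mu + c], while coercivity of [B] forces at least
     [mu + c]. *)
  have [_ [u /= u1 <-]] := inf_adherent c0 E_inf.
  by have := cB u; rewrite BE u1 -/mu; lra.
(* It remains that [lambda_min A <= mu]: [mu] lies in the spectrum, which [muA] bounds below. *)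
apply: le_trans (muA v); rewrite ler_wpM2r ?dotvv_ge0//.
apply: ge_inf => //; exists mu => x /eigenvalue_quad_form.
move=> /(_ symA) [u u0 ux].
by rewrite -(@ler_pM2r _ (dot u u)) ?dotvv_gt0// -ux.
Qed.

End SymmetricSpectrum.

(** * Maxima over finite sets *)

Lemma le_max_over (R : realType) (I : finType) (S : {set I}) (f : I -> R) j :
  j \in S -> f j <= max_over S f.
Proof.
move=> jS; apply: ub_le_sup; last by exists j.
exists (\sum_i `|f i|) => _ [i _ <-].
by rewrite (bigD1 i)//= (le_trans (ler_norm _))// lerDl sumr_ge0.
Qed.

(** The element [j] excludes the empty set, where [max_over] is 0 and may exceed [c]. *)
Lemma max_over_le (R : realType) (I : finType) (S : {set I}) (f : I -> R) j c :
  j \in S -> (forall i, i \in S -> f i <= c) -> max_over S f <= c.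
Proof.
move=> jS fc; apply: ge_sup; first by exists (f j); exists j.
by move=> _ [i iS <-]; exact: fc.
Qed.

(** Row [t] meets only the block of action [a t]; if that action is outside [S], its weights vanish
    and both sides are 0. *)
Lemma design_mul_stack (R : realType) (M d T : nat) (W : 'M[R]_(M, d))
  (S : {set 'I_M}) (z : 'I_T -> 'cV[R]_d) (a : 'I_T -> 'I_M) :
  (forall j, j \notin S -> Wrow W j = 0) ->
  design z a S *m stack W S = \col_t dot (Wrow W (a t)) (z t).
Proof.
move=> W0; rewrite mul_mxrow_mxcol; apply/colP => t.
rewrite summxE mxE.
have blockE (j : 'I_M) : (design_block z a j *m Wrow W j) t 0 =
    if j == a t then dot (Wrow W (a t)) (z t) else 0.
  rewrite mxE eq_sym; case: eqP => [<-|ne].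
    by apply: eq_bigr => c _; rewrite mxE eqxx mulrC.
  by apply: big1 => c _; rewrite mxE; case: eqP ne => // _ _; rewrite mul0r.
under eq_bigr do rewrite blockE.
rewrite -(big_enum_val (fun j => if j == a t then _ else 0)) /=.
rewrite -big_mkcondr /=.
have [aS|/W0 ->] := boolP (a t \in S).
  rewrite (big_pred1 (a t))// => j /=.
  by case: eqP => [->|]; rewrite ?aS ?andbF.
by rewrite /dot !big1// => i *; rewrite ?mxE ?big1// => *; rewrite ?mxE mul0r.
Qed.

(* Comparing the residual of [w] with that of [w0] gives the basic inequality
   [|A h|^2 <= 2 <A^T e, h>] for [h = w - w0]. *)
Lemma least_squares_error (R : realType) (m n : nat) (A : 'M[R]_(m, n))
  (w0 w : 'cV[R]_n) (e : 'cV[R]_m) (c : R) : 0 < c ->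
  c <= lambda_min (A^T *m A) -> is_least_squares A (A *m w0 + e) w ->
  norm2 (w - w0) <= 2 / c * norm2 (A^T *m e).
Proof.
move=> c0 cA lsq; pose h := w - w0.
have symG : (A^T *m A)^T = A^T *m A by rewrite trmx_mul trmxK.
have := lambda_min_le_quad_form h symG.
rewrite -mulmxA dot_mulmxr trmxK => Gh.
have := lsq w0; rewrite !norm2_sqr.
have -> : A *m w0 + e - A *m w0 = e by rewrite addrAC subrr add0r.
have -> : A *m w0 + e - A *m w = e - A *m h.
  by rewrite mulmxBr opprB addrCA addrA.
rewrite !dotE (dotC (A *m h) e) dot_mulmxr => basic.
have CS := dot_le (A^T *m e) h.
have ch : c * dot h h <= 2 * (norm2 (A^T *m e) * norm2 h).
  by have := ler_wpM2r (dotvv_ge0 h) cA; lra.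
rewrite -/h mulrAC ler_pdivlMr//.
(* [ch] is quadratic in [norm2 h]; one factor is cancelled once it is nonzero. *)
have [->|h0] := eqVneq (norm2 h) 0.
  by rewrite mul0r mulr_ge0// norm2_ge0.
have h_gt0 : 0 < norm2 h by rewrite lt0r h0 norm2_ge0.
by rewrite -(ler_pM2r h_gt0); move: ch; rewrite -norm2_sqr; nra.
Qed.

Lemma greedy_regret (R : realType) (I : finType) (d : nat) (S : {set I})
  (V W : I -> 'cV[R]_d) (x : 'cV[R]_d) (b : I) :
  is_argmax S (fun j => dot (V j) x) b ->
  max_over S (fun j => dot (W j) x) - dot (W b) x <=
    2 * max_over S (fun j => norm2 (V j - W j)) * norm2 x.
Proof.
move=> [bS bmax]; set err := max_over S (fun j => norm2 _).
have dev j : j \in S -> `|dot (V j) x - dot (W j) x| <= err * norm2 x.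
  move=> jS; rewrite -dotNl -dotDl.
  apply: (@le_trans _ _ (norm2 (V j - W j) * norm2 x)); last first.
    rewrite ler_wpM2r ?norm2_ge0//.
    exact: (@le_max_over _ _ _ (fun j => norm2 (V j - W j))).
  by rewrite ler_norml dot_le andbT lerNl -dotNl -(norm2N (V j - _)) dot_le.
(* For each rival [i], pass from its true to its estimated reward, then to the estimated and the
   true reward of [b]. *)
rewrite lerBlDr; apply: (max_over_le bS) => i iS.
have := bmax i iS; have := dev i iS; have := dev b bS.
by rewrite !ler_norml => /andP[? ?] /andP[? ?] ?; lra.
Qed.

(** Equality of the two maxima is a premise of the bounds over all actions: actions outside [Sstar]
    have reward 0, which wins if all rewards on a nonempty [Sstar] are negative. *)
Theorem theorem4p7 (R : realType) (disp : measure_display)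
  (Omega : measurableType disp) (P : probability Omega R)
  (M d T k : nat) (hT : (0 < T)%N)
  (Sstar : {set 'I_M}) (hk : #|Sstar| = k)
  (Wstar : 'M[R]_(M, d))
  (hW : forall a, a \notin Sstar -> Wrow Wstar a = 0)
  (z : 'I_T -> Omega -> 'cV[R]_d) (a : 'I_T -> Omega -> 'I_M)
  (eps r : 'I_T -> Omega -> R)
  (hr : forall t w, r t w = dot (Wrow Wstar (a t w)) (z t w) + eps t w)
  (Sigma : 'M[R]_d) (kappa Lambda Lz Leps : R)
  (hkappa : 0 < kappa) (hLambda : 0 < Lambda)
  (z_rv : forall t, random_element (z t))
  (z_indep : mutually_independent P z)
  (z_mean : forall t, mean_zero_vec P (z t))
  (z_cov : forall t, has_covariance P (z t) Sigma)
  (Sigma_pd : posdef Sigma)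
  (Sigma_min : kappa <= lambda_min Sigma)
  (Sigma_minmax : lambda_min Sigma <= lambda_max Sigma)
  (Sigma_max : lambda_max Sigma <= Lambda)
  (z_psi2 : forall t, (psi2_norm_vec P (z t) <= Lz%:E)%E)
  (eps_rv : forall t, random_element (eps t))
  (eps_indep : mutually_independent P eps)
  (eps_mean : forall t, ('E_P[eps t] = 0)%E)
  (eps_psi2 : forall t, (psi2_norm P (eps t) <= Leps%:E)%E)
  (eps_z_indep :
     independent_sigma P (sigma_of_family eps) (sigma_of_family z))
  (alpha : R) (halpha : 0 < alpha)
  (Shat : Omega -> {set 'I_M})
  (what : Omega -> forall S : {set 'I_M}, 'cV[R]_(\sum_(i < #|S|) d))
  (hwhat : forall w,
     is_least_squares (design (z ^~ w) (a ^~ w) (Shat w)) (\col_t r t w)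
       (what w (Shat w))) :
  forall w : Omega,
    Shat w = Sstar ->
    alpha * T%:R <= lambda_min (gram (z ^~ w) (a ^~ w) Sstar) ->
    let What := block (what w (Shat w)) in
    let err := max_over Sstar (fun j => norm2 (What j - Wrow Wstar j)) in
    norm2 (what w Sstar - stack Wstar Sstar)
      <= 2 / (alpha * T%:R)
         * norm2 ((design (z ^~ w) (a ^~ w) Sstar)^T *m (\col_t eps t w))
    /\
    forall (x : 'cV[R]_d) (ahat : 'I_M),
      let reward := fun j => dot (Wrow Wstar j) x in
      is_argmax (Shat w) (fun j => dot (What j) x) ahat ->
      max_over Sstar reward - reward ahat <= 2 * err * norm2 x
      /\
      (max_over [set: 'I_M] reward = max_over Sstar reward ->
        (forall astar : 'I_M, is_argmax [set: 'I_M] reward astar ->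
           reward astar - reward ahat <= 2 * err * norm2 x)
        /\ max_over [set: 'I_M] reward - reward ahat <= 2 * err * norm2 x).
Proof.
move=> w hS hlam What err.
(* The type of [what w (Shat w)] depends on [Shat w], so [What] and [err] are unfolded for [hS] to
   rewrite all occurrences at once. *)
have lsq := hwhat w; subst What err; move: lsq; rewrite hS => lsq.
split.
  apply: least_squares_error => //; first by rewrite mulr_gt0// ltr0n.
  rewrite design_mul_stack//; congr is_least_squares: lsq.
  by apply/colP => t; rewrite !mxE hr.
move=> x b reward hb; have regret := greedy_regret (Wrow Wstar) hb.
split=> // max_eq; rewrite max_eq; split=> // astar _.
(* The reward of [astar] is at most the maximum over all actions, which [max_eq] turns into that
   over [Sstar]. *)
by apply: le_trans regret; rewrite lerB// -max_eq le_max_over// inE.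
Qed.
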